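(* Let $\mathcal{C}$ be a binary linear code of length $n$ and dimension $k$, used with BPSK (codeword $\underline c$ mapped to $\underline s$ with $s_t=1-2c_t$) over the AWGN channel $\underline y=\underline s+\underline z$, $\underline z$ with i.i.d. $\mathcal{N}(0,\sigma^2)$ components, $\sigma>0$, and maximum-likelihood decoding. Assume the all-zero codeword $\underline c^{(0)}$ is transmitted and let $E=\bigcup_{\underline s\neq\underline s^{(0)}}\{\underline s^{(0)}\to\underline s\}$. Let $\underline c^{(1)},\underline c^{(2)}$ be fixed codewords with $d_1=W_H(\underline c^{(1)})\ge1$, $d_2=W_H(\underline c^{(2)})\ge1$, $d_{1,2}=W_H(\underline c^{(2)}-\underline c^{(1)})\ge1$, and let $\{C_{i,j,h}\}$ be the tetrahedron spectrum with respect to $\underline c^{(1)},\underline c^{(2)}$. Then $${\rm Pr}\{E\}\le-(2^k-4)\,p_3(d_2,d_{1,2})+\sum_{1\le i,j,h\le n}C_{i,j,h}\,p_4(i,j,h),$$ where the quantities $p_3$ and $p_4$ are as defined in the context.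
   Context: $W_H$ is Hamming weight; $\{\underline s^{(0)}\to\underline s\}=\{\underline y:\|\underline y-\underline s\|\le\|\underline y-\underline s^{(0)}\|\}$; $f(x)=\frac{1}{\sqrt{2\pi}\sigma}e^{-x^2/(2\sigma^2)}$. $C_{i,j,h}$ is the number of codewords $\underline c$ with $W_H(\underline c)=i$, $W_H(\underline c-\underline c^{(1)})=j$, $W_H(\underline c-\underline c^{(2)})=h$ (so the sum over $i,j,h\ge1$ counts codewords other than $\underline c^{(0)},\underline c^{(1)},\underline c^{(2)}$). $p_3(d_2,d_{1,2})=1-\iint_{\Omega_3}f(\xi_1)f(\xi_2)d\xi_1d\xi_2$ with $\Omega_3=\{\xi_1<\sqrt{d_1},\ \xi_1\cos\theta+\xi_2\sin\theta<\sqrt{d_2}\}$, $\cos\theta=(d_1+d_2-d_{1,2})/(2\sqrt{d_1d_2})$, $\theta\in(0,\pi)$; it equals ${\rm Pr}\{(\underline s^{(0)}\to\underline s^{(1)})\cup(\underline s^{(0)}\to\underline s^{(2)})\}$. For a codeword $\underline c$ counted in $C_{i,j,h}$: choose orthonormal coordinates $(\xi_1,\xi_2,\xi_3)$ of a 3-dimensional subspace containing $\underline s^{(1)}-\underline s^{(0)},\underline s^{(2)}-\underline s^{(0)},\underline s-\underline s^{(0)}$ with $\underline s^{(1)}-\underline s^{(0)}$ along the positive $\xi_1$-axis, $\underline s^{(2)}-\underline s^{(0)}$ having unit direction $(\cos\theta,\sin\theta,0)$, and $\underline s-\underline s^{(0)}$ having unit direction $(\sin\phi\cos\alpha,\sin\phi\sin\alpha,\cos\phi)$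 with $\phi\in[0,\pi/2]$ (the angles $\alpha,\phi$ are determined by $d_1,d_2,d_{1,2},i,j,h$). Then $p_4(i,j,h)=1-\iiint_{\Omega}f(\xi_1)f(\xi_2)f(\xi_3)d\xi_1d\xi_2d\xi_3$ with $\Omega=\{\xi_1<\sqrt{d_1},\ \xi_1\cos\theta+\xi_2\sin\theta<\sqrt{d_2},\ \xi_1\sin\phi\cos\alpha+\xi_2\sin\phi\sin\alpha+\xi_3\cos\phi<\sqrt i\}$; it equals ${\rm Pr}\{(\underline s^{(0)}\to\underline s^{(1)})\cup(\underline s^{(0)}\to\underline s^{(2)})\cup(\underline s^{(0)}\to\underline s)\}$. *)

(* Defs.v *)
From HB Require Import structures.
From mathcomp Require Import all_boot all_order all_algebra all_field.
From mathcomp Require Import all_classical all_reals all_analysis.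
Set Implicit Arguments. Unset Strict Implicit. Unset Printing Implicit Defensive.
Import Order.TTheory GRing.Theory Num.Theory.
Import numFieldNormedType.Exports.
Local Open Scope classical_set_scope.
Local Open Scope ring_scope.

Definition wH (n : nat) (c : 'rV['F_2]_n) : nat := #|[set t : 'I_n | c 0 t != 0]|.

Definition bpsk (R : realType) (n : nat) (c : 'rV['F_2]_n) (t : 'I_n) : R :=
  if c 0 t == 0 then 1 else -1.

Definition sqdist (R : realType) (n : nat) (y s : 'I_n -> R) : R :=
  \sum_(t < n) (y t - s t) ^+ 2.

Definition gdens (R : realType) (sigma : R) (x : R) : R :=
  (Num.sqrt (2 * pi) * sigma)^-1 * expR (- (x ^+ 2) / (2 * sigma ^+ 2)).

(* Integral of F against the joint density of n i.i.d. N(0, sigma^2) variables: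
   gauss_iter n F = \int ... \int F(x_1,...,x_n) f(x_1)...f(x_n) dx_1...dx_n
   (iterated Lebesgue integrals). *)
Fixpoint gauss_iter (R : realType) (sigma : R) (n : nat) :
    (n.-tuple R -> \bar R) -> \bar R :=
  match n return (n.-tuple R -> \bar R) -> \bar R with
  | 0 => fun F => F [tuple]
  | m.+1 => fun F =>
      (\int[@lebesgue_measure R]_x
         ((gdens sigma x)%:E * gauss_iter sigma (fun t : m.-tuple R => F (cons_tuple x t))))%E
  end.

Definition gauss_prob (R : realType) (sigma : R) (n : nat) (A : set (n.-tuple R)) : \bar R :=
  gauss_iter sigma (fun z => ((\1_A z : R))%:E).

(* The error event E = union over s <> s^(0) of {s^(0) -> s}, expressed on the noise z,
   with y = s^(0) + z, s^(0) = bpsk 0 (all-zero codeword transmitted). *)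
Definition received (R : realType) (n : nat) (z : n.-tuple R) (t : 'I_n) : R :=
  bpsk R 0 t + tnth z t.

Definition error_event (R : realType) (n : nat) (C : {vspace 'rV['F_2]_n}) : set (n.-tuple R) :=
  [set z | exists c : 'rV['F_2]_n, [/\ c \in C, c != 0 &
      sqdist (received z) (bpsk R c) <= sqdist (received z) (bpsk R 0)]].

Definition tetra_spec (n : nat) (C : {vspace 'rV['F_2]_n}) (c1 c2 : 'rV['F_2]_n)
    (i j h : nat) : nat :=
  #|[set c : 'rV['F_2]_n | [&& c \in C, wH c == i, wH (c - c1) == j & wH (c - c2) == h]]|.

Definition theta (R : realType) (d1 d2 d12 : nat) : R :=
  acos ((d1%:R + d2%:R - d12%:R) / (2 * Num.sqrt (d1%:R * d2%:R))).

Definition p3 (R : realType) (sigma : R) (d1 d2 d12 : nat) : R :=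
  let th := theta R d1 d2 d12 in
  1 - fine (gauss_prob sigma
    [set xi : 2.-tuple R | tnth xi ord0 < Num.sqrt d1%:R /\
        tnth xi ord0 * cos th + tnth xi (inord 1) * sin th < Num.sqrt d2%:R]).

(* Unit direction (sin phi cos alpha, sin phi sin alpha, cos phi) of s - s^(0) in the
   orthonormal frame of the context, phi in [0, pi/2]:
   - first component = cos of angle with s1 - s0 = (d1 + i - j)/(2 sqrt(d1 i));
   - cos th * u1 + sin th * u2 = cos of angle with s2 - s0 = (d2 + i - h)/(2 sqrt(d2 i));
   - third component cos phi >= 0 completes a unit vector. *)
Definition dir1 (R : realType) (d1 i j : nat) : R :=
  (d1%:R + i%:R - j%:R) / (2 * Num.sqrt (d1%:R * i%:R)).
Definition dir2 (R : realType) (d1 d2 d12 i j h : nat) : R :=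
  let th := theta R d1 d2 d12 in
  ((d2%:R + i%:R - h%:R) / (2 * Num.sqrt (d2%:R * i%:R)) - dir1 R d1 i j * cos th) / sin th.
Definition dir3 (R : realType) (d1 d2 d12 i j h : nat) : R :=
  Num.sqrt (1 - dir1 R d1 i j ^+ 2 - dir2 R d1 d2 d12 i j h ^+ 2).

Definition p4 (R : realType) (sigma : R) (d1 d2 d12 i j h : nat) : R :=
  let th := theta R d1 d2 d12 in
  1 - fine (gauss_prob sigma
    [set xi : 3.-tuple R | [/\ tnth xi ord0 < Num.sqrt d1%:R,
        tnth xi ord0 * cos th + tnth xi (inord 1) * sin th < Num.sqrt d2%:R &
        tnth xi ord0 * dir1 R d1 i j + tnth xi (inord 1) * dir2 R d1 d2 d12 i j h
          + tnth xi (inord 2) * dir3 R d1 d2 d12 i j h < Num.sqrt i%:R]]).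

(* Main.v *)
Require Import Defs.
From HB Require Import structures.
From mathcomp Require Import all_boot all_order all_algebra all_field.
From mathcomp Require Import all_classical all_reals all_analysis.
From mathcomp Require Import measurable_realfun ring lra.
Import Order.TTheory GRing.Theory Num.Theory.
Import numFieldNormedType.Exports.
Set Implicit Arguments. Unset Strict Implicit. Unset Printing Implicit Defensive.
Local Open Scope classical_set_scope.
Local Open Scope ring_scope.

(* Let A be the event that neither s^(1) nor s^(2) beats s^(0), and A_c the event
   that moreover s (the image of c) does not.  Each noise z satisfies
     1_E + 1_A + sum_c 1_(A_c) <= 1 + sum_c 1_A,
   with c ranging over the 2^k - 3 codewords other than c^(0), c^(1), c^(2): if z
   is in A and in E, then some s different from s^(1) and s^(2) beats s^(0).
   Integrating this inequality gives the bound, provided that Pr A = 1 - p3 and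
   Pr A_c = 1 - p4.

   A and A_c are intersections of half-spaces <z, u_i> < b_i, i = 1, 2, 3.  With
   v_t = (u_1 t, u_2 t, u_3 t), they say that sum_t z_t v_t lies in an orthant of
   R^3.  The law of sum_t z_t v_t is unchanged when two of the columns v_t are
   rotated into each other, since the Gaussian density is radial and a plane
   rotation is a product of shears.  Such rotations preserve the Gram matrix of
   the u_i and reduce the columns to three forming a triangular matrix, which is
   then the Cholesky factor of the Gram matrix; its entries are the direction
   cosines in the definitions of p3 and p4. *)

(** * Rotation invariance of the Lebesgue measure of the plane *)

Section lebesgue_plane.
Context (R : realType).
Notation mu := (@lebesgue_measure R).
Local Open Scope ereal_scope.

(** The push-forward of Lebesgue measure under a translation gives each half-open interval its
    length, so by uniqueness it is Lebesgue measure. *)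
Lemma ge0_integral_shift (a : R) (g : R -> \bar R) :
  measurable_fun [set: R] g -> (forall x, 0 <= g x) ->
  \int[mu]_x g (x + a)%R = \int[mu]_x g x.
Proof.
move=> mg g0.
pose phi : measurableTypeR R -> measurableTypeR R := fun x : R => (x + a)%R.
have mphi : measurable_fun setT phi.
  have : measurable_fun [set: R] (fun x : R => (x + a)%R) by apply: measurable_funD.
  exact.
have mu_nu : forall A, measurable A -> mu A = pushforward mu phi A.
  apply: lebesgue_measure_unique => //= X [[b c] _ <-] /=.
  rewrite /pushforward /=.
  have -> : phi @^-1` [set` `]b, c]] =
            [set` `](b - a)%R, (c - a)%R]].
    by apply/seteqP; split => x /=; rewrite !in_itv /= ltrBlDr lerBrDr.
  rewrite !lebesgue_measure_itv /= !lte_fin ltrD2r.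
  by case: ifP => // _; rewrite -!EFinB; congr EFin; ring.
have -> : \int[mu]_x g x = \int[pushforward mu phi]_x g x.
  by apply: eq_measure_integral => A mA _; exact: mu_nu.
by rewrite (@ge0_integral_pushforward _ _ _ _ _ phi mphi)// preimage_setT.
Qed.

Lemma fubini_tonelli_lebesgue (K : R * R -> \bar R) :
  measurable_fun [set: R * R] K -> (forall p, 0 <= K p) ->
  \int[mu]_x \int[mu]_y K (x, y) = \int[mu]_y \int[mu]_x K (x, y).
Proof.
move=> mK K0.
exact: (@fubini_tonelli _ _ (measurableTypeR R) (measurableTypeR R) R mu mu K).
Qed.

(** For fixed [y] this shear is a translation in [x]; Tonelli makes [x] the inner variable. *)
Lemma ge0_integral_shear1 (a : R) (K : R * R -> \bar R) :
  measurable_fun [set: R * R] K -> (forall p, 0 <= K p) ->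
  \int[mu]_x \int[mu]_y K (x + a * y, y)%R = \int[mu]_x \int[mu]_y K (x, y).
Proof.
move=> mK K0.
rewrite (fubini_tonelli_lebesgue (K := fun p : R * R => K (p.1 + a * p.2, p.2)%R))//=; last first.
  apply: measurableT_comp => //; apply: measurable_fun_pair => //.
  apply: measurable_funD => //; exact: measurable_funM.
rewrite [RHS](fubini_tonelli_lebesgue mK)//.
apply: eq_integral => y _.
rewrite (ge0_integral_shift (a * y)%R (g := fun x => K (x, y)))//.
exact: measurableT_comp.
Qed.

Lemma ge0_integral_shear2 (a : R) (K : R * R -> \bar R) :
  measurable_fun [set: R * R] K -> (forall p, 0 <= K p) ->
  \int[mu]_x \int[mu]_y K (x, y + a * x)%R = \int[mu]_x \int[mu]_y K (x, y).
Proof.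
move=> mK K0; apply: eq_integral => x _.
rewrite (ge0_integral_shift (a * x)%R (g := fun y => K (x, y)))//.
exact: measurableT_comp.
Qed.

Let measurable_lin2 (a b : R) :
  measurable_fun [set: R * R] (fun p : R * R => a * p.1 + b * p.2)%R.
Proof.
apply: measurable_funD.
  by apply: (@measurable_funM _ (R * R)%type R setT (cst a) fst).
by apply: (@measurable_funM _ (R * R)%type R setT (cst b) snd).
Qed.

(* A rotation by an angle which is not a multiple of pi is the product of three
   shears, with slopes (c - 1) / s, s and (c - 1) / s. *)
Let ge0_integral_rotation_neq0 (c s : R) (K : R * R -> \bar R) :
  (c ^+ 2 + s ^+ 2 = 1)%R -> s != 0%R ->
  measurable_fun [set: R * R] K -> (forall p, 0 <= K p) ->
  \int[mu]_x \int[mu]_y K (c * x - s * y, s * x + c * y)%R =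
  \int[mu]_x \int[mu]_y K (x, y).
Proof.
move=> cs1 s0 mK K0; pose a := ((c - 1) / s)%R.
have mlin (g : R * R -> R * R) (b1 b2 b3 b4 : R) :
    (forall p, g p = (b1 * p.1 + b2 * p.2, b3 * p.1 + b4 * p.2)%R) ->
    measurable_fun [set: R * R] (K \o g).
  move=> /funext ->; apply: measurableT_comp => //; exact: measurable_fun_pair.
rewrite -(ge0_integral_shear1 a mK K0).
rewrite -(ge0_integral_shear2 s
    (K := K \o (fun p => (p.1 + a * p.2, p.2)%R)) _ (fun=> K0 _))//; last first.
  by apply: (mlin _ 1 a 0 1)%R => p; rewrite !mul1r mul0r add0r.
rewrite -(ge0_integral_shear1 a
    (K := K \o (fun p => (p.1 + a * (p.2 + s * p.1), p.2 + s * p.1)%R)) _ (fun=> K0 _))//; last first.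
  apply: (mlin _ (1 + a * s) a s 1)%R => p /=.
  by congr pair; ring.
apply: eq_integral => x _; apply: eq_integral => y _ /=.
congr (K (_, _)).
- have as1 : (a * s = c - 1)%R by rewrite /a divfK.
  (* Since [c ^+ 2 - 1 = - s ^+ 2]. The coefficient of [y] below is
     [a * (2 + a * s) = a * (1 + c)]. *)
  have aa : (a * (1 + c) = - s)%R.
    by rewrite /a mulrAC; apply: (canLR (mulfK s0)); rewrite mulrDr mulr1 mulrBl; lra.
  have -> : (x + a * y + a * (y + s * (x + a * y)) =
    (1 + a * s) * x + (2 * a + a * (a * s)) * y)%R by ring.
  have -> : (2 * a + a * (a * s) = - s)%R by rewrite as1 -aa; ring.
  by rewrite as1; ring.
- have as1 : (a * s = c - 1)%R by rewrite /a divfK.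
  have -> : (y + s * (x + a * y) = s * x + (1 + a * s) * y)%R by ring.
  by rewrite as1; ring.
Qed.

Lemma ge0_integral_rotation (c s : R) (K : R * R -> \bar R) :
  (c ^+ 2 + s ^+ 2 = 1)%R ->
  measurable_fun [set: R * R] K -> (forall p, 0 <= K p) ->
  \int[mu]_x \int[mu]_y K (c * x - s * y, s * x + c * y)%R =
  \int[mu]_x \int[mu]_y K (x, y).
Proof.
move=> cs1 mK K0.
have [s0|s0] := eqVneq s 0%R; last exact: ge0_integral_rotation_neq0.
have : (c ^+ 2 == 1)%R by rewrite -cs1 s0 expr0n addr0.
rewrite sqrf_eq1 s0 => /orP[]/eqP ->.
  by apply: eq_integral => x _; apply: eq_integral => y _; congr (K (_, _)); ring.
(* The half-turn [c = -1] is the square of a quarter turn, whose sine is nonzero. *)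
have e01 : (0 ^+ 2 + 1 ^+ 2 = 1 :> R)%R by ring.
have mK' : measurable_fun setT
    (fun p : R * R => K (0 * p.1 - 1 * p.2, 1 * p.1 + 0 * p.2)%R).
  apply: measurableT_comp => //; apply: measurable_fun_pair => //.
  by under eq_fun do rewrite -mulNr; exact: measurable_lin2.
rewrite -(ge0_integral_rotation_neq0 e01 (oner_neq0 _) mK K0).
rewrite -(ge0_integral_rotation_neq0 e01 (oner_neq0 _) mK' (fun=> K0 _)).
by apply: eq_integral => x _; apply: eq_integral => y _ /=; congr (K (_, _)); ring.
Qed.

End lebesgue_plane.

(** * The centered Gaussian density *)

Section gdens.
Context (R : realType) (sigma : R).
Hypothesis sigma0 : 0 < sigma.
Notation mu := (@lebesgue_measure R).

Lemma gdens_ge0 x : 0 <= gdens sigma x.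
Proof. by rewrite mulr_ge0 ?expR_ge0// invr_ge0 mulr_ge0// ltW. Qed.

Lemma gdens_normal_pdf x : gdens sigma x = normal_pdf 0 sigma x.
Proof.
rewrite normal_pdfE ?gt_eqF// /gdens /normal_peak /normal_fun subr0.
rewrite -mulrnAr [in RHS]sqrtrM ?sqr_ge0// sqrtr_sqr gtr0_norm// -[sigma ^+ 2 *+ 2]mulr_natl.
by rewrite -[pi *+ 2]mulr_natl [sigma * _]mulrC.
Qed.

Lemma measurable_gdens : measurable_fun [set: R] (gdens sigma).
Proof.
by rewrite (_ : gdens sigma = normal_pdf 0 sigma);
  [exact: measurable_normal_pdf|exact/funext/gdens_normal_pdf].
Qed.

Lemma integral_gdens : (\int[mu]_x (gdens sigma x)%:E = 1)%E.
Proof.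
by under eq_integral do rewrite gdens_normal_pdf; exact: integral_normal_pdf.
Qed.

(** The product density depends only on [x ^+ 2 + y ^+ 2], which the rotation preserves. *)
Lemma gdensM_rotation (c s x y : R) : c ^+ 2 + s ^+ 2 = 1 ->
  gdens sigma (c * x - s * y) * gdens sigma (s * x + c * y) =
  gdens sigma x * gdens sigma y.
Proof.
move=> cs1; rewrite /gdens !mulrA.
rewrite ![_ * _^-1 in LHS]mulrAC ![_ * _^-1 in RHS]mulrAC -!mulrA -!expRD.
congr (_ * (_ * expR _)); rewrite -!mulrDl; congr (_ / _).
transitivity (- ((c ^+ 2 + s ^+ 2) * (x ^+ 2 + y ^+ 2))); first by ring.
by rewrite cs1; ring.
Qed.

End gdens.

(** * Gaussian combinations of columns *)

Section gauss_columns.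
Context (R : realType) (sigma : R).
Hypothesis sigma0 : 0 < sigma.
Notation mu := (@lebesgue_measure R).
Notation V := (R * R * R)%type.
Implicit Types (s t : seq V) (v w p : V) (F : V -> \bar R).

(** The expectation of [F] at [p] plus a combination of the columns [s] with i.i.d. Gaussian
    coefficients; [p] accumulates the columns already met. *)
Fixpoint gauss_cols s F p : \bar R :=
  if s is v :: s' then
    (\int[mu]_x ((gdens sigma x)%:E * gauss_cols s' F (p + x *: v)%R))%E
  else F p.

Lemma gauss_cols_ge0 s F p : (forall q, 0 <= F q)%E -> (0 <= gauss_cols s F p)%E.
Proof.
move=> F0; elim: s p => [//|v s IH] p /=.
by apply: integral_ge0 => x _; rewrite mule_ge0// lee_fin gdens_ge0.
Qed.

Lemma measurable_addZ (d : measure_display) (T : measurableType d)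
    (f : T -> V) (g : T -> R) v :
  measurable_fun [set: T] f -> measurable_fun [set: T] g ->
  measurable_fun [set: T] (fun q => f q + g q *: v : V).
Proof.
move=> mf mg.
rewrite (_ : (fun q => _) = (fun q => ((f q).1.1 + g q * v.1.1,
  (f q).1.2 + g q * v.1.2, (f q).2 + g q * v.2)))//.
have mf1 : measurable_fun [set: T] (fst \o f) by exact: measurableT_comp.
apply: measurable_fun_pair; last first.
  apply: measurable_funD; first exact: (measurableT_comp measurable_snd mf).
  by apply: measurable_funM.
apply: measurable_fun_pair; apply: measurable_funD; try by apply: measurable_funM.
- exact: (measurableT_comp measurable_fst mf1).
- exact: (measurableT_comp measurable_snd mf1).
Qed.

Lemma measurable_gauss_cols s F : measurable_fun [set: V] F ->
  (forall q, 0 <= F q)%E -> measurable_fun [set: V] (gauss_cols s F).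
Proof.
move=> mF F0; elim: s => [//|v s IH] /=.
have mK : measurable_fun [set: V * R]
   (fun q : V * R => ((gdens sigma q.2)%:E * gauss_cols s F (q.1 + q.2 *: v)%R)%E).
  apply: emeasurable_funM.
    apply/measurable_EFinP; apply: measurableT_comp => //.
    exact: measurable_gdens.
  apply: measurableT_comp => //.
  exact: measurable_addZ.
apply: (@measurable_fun_fubini_tonelli_F _ _ V (measurableTypeR R) R mu _ mK).
by move=> q; rewrite mule_ge0 ?gauss_cols_ge0// lee_fin gdens_ge0.
Qed.

(** Substituting [(c * x - r * y, r * x + c * y)] for the two coefficients preserves their joint
    density and regroups [x *: v + y *: w] along the rotated columns. *)
Lemma gauss_cols_rotation (c r : R) v w s F p : c ^+ 2 + r ^+ 2 = 1 ->
  measurable_fun [set: V] F -> (forall q, 0 <= F q)%E ->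
  gauss_cols [:: v, w & s] F p =
  gauss_cols [:: c *: v + r *: w, c *: w - r *: v & s] F p.
Proof.
move=> cr1 mF F0 /=.
pose H := gauss_cols s F.
have H0 q : (0 <= H q)%E by exact: gauss_cols_ge0.
have mH : measurable_fun [set: V] H by exact: measurable_gauss_cols.
pose K (v w : V) (q : R * R) := ((gdens sigma q.1)%:E *
  ((gdens sigma q.2)%:E * H (p + q.1 *: v + q.2 *: w)%R))%E.
have K0 a b q : (0 <= K a b q)%E by rewrite !mule_ge0// lee_fin gdens_ge0.
have mK a b : measurable_fun [set: R * R] (K a b).
  apply: emeasurable_funM.
    apply/measurable_EFinP; apply: measurableT_comp => //.
    exact: measurable_gdens.
  apply: emeasurable_funM.
    apply/measurable_EFinP; apply: measurableT_comp => //.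
    exact: measurable_gdens.
  apply: measurableT_comp => //.
  by apply: measurable_addZ => //; exact: measurable_addZ.
have E a b : (\int[mu]_x ((gdens sigma x)%:E * \int[mu]_y
    ((gdens sigma y)%:E * H (p + x *: a + y *: b)%R)) =
    \int[mu]_x \int[mu]_y K a b (x, y))%E.
  apply: eq_integral => x _; rewrite /K/= ge0_integralZl_EFin//.
  - by move=> y _; rewrite mule_ge0// lee_fin gdens_ge0.
  - apply: emeasurable_funM.
      by apply/measurable_EFinP; exact: measurable_gdens.
    by apply: measurableT_comp => //; exact: measurable_addZ.
  - exact: gdens_ge0.
apply: etrans (E v w) _; apply: etrans _ (esym (E _ _)).
rewrite -(ge0_integral_rotation cr1 (mK v w) (K0 v w)).
apply: eq_integral => x _; apply: eq_integral => y _; rewrite /K/= !muleA -!EFinM.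
rewrite gdensM_rotation//; congr (_ * H _)%E.
rewrite -!addrA; congr +%R; rewrite !scalerDr !scalerN !scalerA !scalerBl !scalerDl.
rewrite ![_ * x]mulrC ![_ * y]mulrC.
by rewrite -!addrA; congr +%R; rewrite addrC -!addrA.
Qed.

Lemma gauss_cols_zero s F p : (forall q, 0 <= F q)%E ->
  gauss_cols (0 :: s) F p = gauss_cols s F p.
Proof.
move=> F0 /=; under eq_integral do rewrite scaler0 addr0.
have mg : measurable_fun [set: measurableTypeR R] (fun x => (gdens sigma x)%:E).
  by apply/measurable_EFinP; exact: measurable_gdens.
rewrite ge0_integralZr//; last exact: gauss_cols_ge0.
  by rewrite integral_gdens// mul1e.
by move=> x _; rewrite lee_fin gdens_ge0.
Qed.

(** Equality in law of two Gaussian combinations. Quantifying over [p] lets a common column be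
    prepended. *)
Definition gauss_cols_equiv s t := forall F p,
  measurable_fun [set: V] F -> (forall q, 0 <= F q)%E ->
  gauss_cols s F p = gauss_cols t F p.

Lemma gauss_cols_equiv_trans s t u :
  gauss_cols_equiv s t -> gauss_cols_equiv t u -> gauss_cols_equiv s u.
Proof. by move=> st tu F p mF F0; rewrite st// tu. Qed.

Lemma gauss_cols_equiv_cons v s t :
  gauss_cols_equiv s t -> gauss_cols_equiv (v :: s) (v :: t).
Proof. by move=> st F p mF F0 /=; apply: eq_integral => x _; rewrite st. Qed.

Lemma gauss_cols_equiv_zeros s t : (forall v, v \in t -> v = 0) ->
  gauss_cols_equiv (s ++ t) s.
Proof.
move=> t0; elim: s => [|v s IH]; last exact: gauss_cols_equiv_cons.
elim: t t0 => [//|v t IH] t0 F p mF F0.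
rewrite /cat (t0 v) ?mem_head// gauss_cols_zero//.
by apply: IH => // w wt; apply: t0; rewrite in_cons wt orbT.
Qed.

(** For coordinate forms this is an entry of the Gram matrix of the rows, that is, a covariance up
    to the factor [sigma ^+ 2]. *)
Definition gram (l l' : V -> R) s := \sum_(v <- s) l v * l' v.

Lemma gram_cons (l l' : V -> R) v s : gram l l' (v :: s) = l v * l' v + gram l l' s.
Proof. by rewrite /gram big_cons. Qed.

Lemma gram_nil (l l' : V -> R) : gram l l' [::] = 0.
Proof. by rewrite /gram big_nil. Qed.

Lemma gram_eq0 (l : V -> R) s : gram l l s = 0 -> forall v, v \in s -> l v = 0.
Proof.
elim: s => [//|v s IH]; rewrite gram_cons => /eqP.
rewrite paddr_eq0 -?expr2 ?sqr_ge0//; last first.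
  by apply: sumr_ge0 => w _; rewrite -expr2 sqr_ge0.
rewrite sqrf_eq0 => /andP[/eqP v0 /eqP /IH s0] w.
by rewrite in_cons => /orP[/eqP ->//|/s0].
Qed.

Lemma gram_vanish (l l' : V -> R) s : (forall v, v \in s -> l v = 0) ->
  gram l l' s = 0.
Proof.
move=> s0; rewrite /gram big_seq big1// => v vs.
by rewrite s0// mul0r.
Qed.

Definition linear_form (l : V -> R) :=
  forall (a b : R) v w, l (a *: v + b *: w) = a * l v + b * l w.

(* One step: with r = sqrt (l w ^+ 2 + l v ^+ 2), the rotation of (w, v) with cosine
   l w / r and sine l v / r makes l vanish on the second column. *)
Lemma gauss_cols_concentrate (l : V -> R) s : linear_form l ->
  exists v t, [/\ gauss_cols_equiv s (v :: t),
    forall l1 l2, linear_form l1 -> linear_form l2 -> gram l1 l2 s = gram l1 l2 (v :: t),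
    0 <= l v & forall w, w \in t -> l w = 0].
Proof.
move=> linl; elim: s => [|w s [v [t [est gst lv lt]]]].
  have lin0 l1 : linear_form l1 -> l1 0 = 0.
    by move=> /(_ 0 0 0 0); rewrite !scale0r addr0 !mul0r addr0.
  exists 0, [::]; split => //.
  - by move=> F p mF F0; rewrite gauss_cols_zero.
  - by move=> l1 l2 /lin0 l10 _; rewrite gram_cons !gram_nil l10 mul0r addr0.
  - by rewrite lin0.
pose r := Num.sqrt (l w ^+ 2 + l v ^+ 2).
have r2 : r ^+ 2 = l w ^+ 2 + l v ^+ 2 by rewrite sqr_sqrtr// addr_ge0 ?sqr_ge0.
have r_ge0 : 0 <= r by exact: sqrtr_ge0.
have [c [d [cd1 cd0 cdr]]] : exists c d, [/\ c ^+ 2 + d ^+ 2 = 1,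
    c * l v - d * l w = 0 & c * l w + d * l v = r].
  (* If [r = 0], both [l w] and [l v] vanish and the identity rotation is taken. *)
  have [r0|r0] := eqVneq r 0.
    exists 1, 0; split; [by ring| |]; move: r2; rewrite r0 expr0n/= => /esym/eqP;
      rewrite paddr_eq0 ?sqr_ge0// !sqrf_eq0 => /andP[/eqP -> /eqP ->]; ring.
  exists (l w / r), (l v / r); split; last 2 first.
  - by ring.
  - by rewrite mulrAC [l v / r * _]mulrAC -mulrDl -!expr2 -r2 expr2 mulfK.
  - by rewrite !expr_div_n -mulrDl -r2 divff// expf_neq0.
exists (c *: w + d *: v), ((c *: v - d *: w) :: t); split.
- apply: gauss_cols_equiv_trans (gauss_cols_equiv_cons _ est) _.
  by move=> F p mF F0; exact: gauss_cols_rotation.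
- move=> l1 l2 lin1 lin2; rewrite gram_cons gst// !gram_cons !addrA; congr +%R.
  rewrite -scaleNr lin1 lin1 lin2 lin2.
  rewrite -[LHS]mul1r -cd1; ring.
- by rewrite linl cdr.
- move=> u; rewrite in_cons => /orP[/eqP ->|/lt//].
  by rewrite -scaleNr linl mulNr.
Qed.

(** Coordinates are concentrated one after the other: the first in [v], the second of what remains
    in [w], then the third in [z]; any further column is zero. *)
Lemma gauss_cols_triangular s : exists v w z,
  [/\ gauss_cols_equiv s [:: v; w; z],
    forall l1 l2, linear_form l1 -> linear_form l2 -> gram l1 l2 s = gram l1 l2 [:: v; w; z],
    [/\ 0 <= v.1.1, 0 <= w.1.2 & 0 <= z.2] &
    [/\ w.1.1 = 0, z.1.1 = 0 & z.1.2 = 0]].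
Proof.
pose l1 (v : V) := v.1.1; pose l2 (v : V) := v.1.2; pose l3 (v : V) := v.2.
have lin1 : linear_form l1 by [].
have lin2 : linear_form l2 by [].
have lin3 : linear_form l3 by [].
have [v [t [est gst v0 t0]]] := gauss_cols_concentrate s lin1.
have [w [u [etu gtu w0 u0]]] := gauss_cols_concentrate t lin2.
have [z [q [euq guq z0 q0]]] := gauss_cols_concentrate u lin3.
(* Later rotations keep the sum of squared first coordinates, here zero, so these coordinates stay
   zero. *)
have wu0 : forall x, x \in w :: u -> l1 x = 0.
  by apply: gram_eq0; rewrite -gtu// gram_vanish.
have zq0 : forall x, x \in z :: q -> l1 x = 0.
  apply: gram_eq0; rewrite -guq// gram_vanish// => x xu.
  by apply: wu0; rewrite in_cons xu orbT.
have zq2 : forall x, x \in z :: q -> l2 x = 0.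
  by apply: gram_eq0; rewrite -guq// gram_vanish.
have qz : forall x, x \in q -> x = 0.
  move=> x xq; have xzq : x \in z :: q by rewrite in_cons xq orbT.
  move: (zq0 _ xzq) (zq2 _ xzq) (q0 _ xq); rewrite /l1 /l2 /l3.
  by case: x {xq xzq} => -[x1 x2] x3 /= -> -> ->.
exists v, w, z; split.
- apply: gauss_cols_equiv_trans est _; apply: gauss_cols_equiv_cons.
  apply: gauss_cols_equiv_trans etu _; apply: gauss_cols_equiv_cons.
  apply: gauss_cols_equiv_trans euq _.
  exact: (@gauss_cols_equiv_zeros [:: z]).
- move=> f g linf ling; rewrite gst// gram_cons gtu// gram_cons guq// !gram_cons.
  rewrite gram_nil (@gram_vanish _ _ q)// => x /qz ->.
  by move: (linf 0 0 0 0); rewrite !scale0r addr0 !mul0r addr0.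
- by split.
- by split; [apply: wu0|apply: zq0|apply: zq2]; rewrite mem_head.
Qed.

(* Uniqueness of the Cholesky factor of the Gram matrix *)
Theorem gauss_cols_gram s (a11 a21 a31 a22 a32 a33 : R) :
  0 < a11 -> 0 < a22 ->
  gram (fun v => v.1.1) (fun v => v.1.1) s = a11 ^+ 2 ->
  gram (fun v => v.1.1) (fun v => v.1.2) s = a11 * a21 ->
  gram (fun v => v.1.1) (fun v => v.2) s = a11 * a31 ->
  gram (fun v => v.1.2) (fun v => v.1.2) s = a21 ^+ 2 + a22 ^+ 2 ->
  gram (fun v => v.1.2) (fun v => v.2) s = a21 * a31 + a22 * a32 ->
  a33 = Num.sqrt (gram (fun v => v.2) (fun v => v.2) s - a31 ^+ 2 - a32 ^+ 2) ->
  gauss_cols_equiv s [:: (a11, a21, a31); (0, a22, a32); (0, 0, a33)].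
Proof.
move=> p1 p2.
have [[[v1 v2] v3] [[[w1 w2] w3] [[[z1 z2] z3] [es gs]]]] := gauss_cols_triangular s.
move=> /= [v0 w0 z0] [w10 z10 z20].
have gE (f g : V -> R) : linear_form f -> linear_form g -> gram f g s =
    f (v1, v2, v3) * g (v1, v2, v3) + (f (w1, w2, w3) * g (w1, w2, w3) +
    (f (z1, z2, z3) * g (z1, z2, z3) + 0)).
  by move=> linf ling; rewrite gs// !gram_cons gram_nil.
have lin1 : linear_form (fun v => v.1.1) by [].
have lin2 : linear_form (fun v => v.1.2) by [].
have lin3 : linear_form (fun v => v.2) by [].
rewrite (gE _ _ lin1 lin1) (gE _ _ lin1 lin2) (gE _ _ lin1 lin3).
rewrite (gE _ _ lin2 lin2) (gE _ _ lin2 lin3) (gE _ _ lin3 lin3).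
rewrite /= w10 z10 z20 !mul0r !addr0.
have sq (x y : R) : 0 <= x -> 0 <= y -> x * x = y ^+ 2 -> x = y.
  move=> x0 y0 /eqP; rewrite -expr2 eqrXn2// => /eqP. exact.
(* Diagonal entries follow from uniqueness of nonnegative square roots, off-diagonal ones by
   cancelling the pivots [a11] and [a22]. *)
move=> /sq E1; have {E1} E1 : v1 = a11 by apply: E1 => //; exact: ltW.
rewrite {}E1 in es * => /(mulfI (lt0r_neq0 p1)) E2 /(mulfI (lt0r_neq0 p1)) E3.
rewrite {}E2 {}E3 in es *.
rewrite -expr2 => /addrI/sq E4; have {E4} E4 : w2 = a22 by apply: E4 => //; exact: ltW.
rewrite {}E4 in es * => /addrI/(mulfI (lt0r_neq0 p2)) E5; rewrite {}E5 in es *.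
(* The radicand is [z3 ^+ 2]; linearly dependent rows, where [a33 = 0], are covered. *)
rewrite -!expr2 [X in Num.sqrt X](_ : _ = z3 ^+ 2); last by ring.
rewrite sqrtr_sqr (ger0_norm z0) => ->.
rewrite w10 z10 z20 in es; exact: es.
Qed.

(** Passes from noise vectors to columns, for integrands that see the noise only through an affine
    image in [V]. *)
Lemma gauss_iter_linear n (vs : n.-tuple V) F p :
  gauss_iter sigma (fun z : n.-tuple R => F (p + \sum_(i < n) tnth z i *: tnth vs i)) =
  gauss_cols vs F p.
Proof.
elim: n vs p => [|n IH] vs p /=.
  by rewrite big_ord0 addr0 tuple0.
case/tupleP: vs => v vs /=; apply: eq_integral => x _; congr (_ * _)%E.
rewrite -IH; congr gauss_iter; apply/funext => z.
rewrite big_ord_recl !tnth0 addrA; congr (F (_ + _)).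
by apply: eq_bigr => i _; rewrite !tnthS.
Qed.

End gauss_columns.

(** * Iterated Gaussian integrals *)

Section gauss_iter.
Context (R : realType) (sigma : R).
Hypothesis sigma0 : 0 < sigma.
Notation mu := (@lebesgue_measure R).
Local Open Scope ereal_scope.

Lemma gauss_iter_ge0 n (F : n.-tuple R -> \bar R) :
  (forall z, 0 <= F z) -> 0 <= gauss_iter sigma F.
Proof.
elim: n F => [|n IH] F F0 //=.
by apply: integral_ge0 => x _; rewrite mule_ge0 ?IH// lee_fin gdens_ge0.
Qed.

(** The parameter space [T] is arbitrary so that the induction can move the first coordinate into
    it. *)
Lemma measurable_gauss_iter n (d : measure_display) (T : measurableType d)
    (F : T -> n.-tuple R -> \bar R) :
  measurable_fun [set: T * n.-tuple R] (fun q => F q.1 q.2) ->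
  (forall t z, 0 <= F t z) ->
  measurable_fun [set: T] (fun t => gauss_iter sigma (F t)).
Proof.
elim: n d T F => [|n IH] d T F mF F0 /=.
  apply: (measurableT_comp mF (g := fun t => (t, [tuple]))).
  exact: measurable_fun_pair.
pose F' (q : T * R) (z : n.-tuple R) := F q.1 (cons_tuple q.2 z).
have mF' : measurable_fun [set: T * R] (fun q => gauss_iter sigma (F' q)).
  apply: IH; last by move=> ? ?; exact: F0.
  apply: (measurableT_comp mF (g := fun q : T * R * n.-tuple R =>
     (q.1.1, cons_tuple q.1.2 q.2))).
  apply: measurable_fun_pair; first exact: measurableT_comp.
  by apply: measurable_cons => //; exact: measurableT_comp.
apply: (@measurable_fun_fubini_tonelli_F _ _ T (measurableTypeR R) R mu
  (fun q : T * R => (gdens sigma q.2)%:E * gauss_iter sigma (F' q))).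
  apply: emeasurable_funM => //.
  by apply/measurable_EFinP; apply: measurableT_comp => //; exact: measurable_gdens.
move=> q; apply: mule_ge0; first by rewrite lee_fin gdens_ge0.
by apply: gauss_iter_ge0 => z; exact: F0.
Qed.

Lemma measurable_gauss_iter_cons n (F : n.+1.-tuple R -> \bar R) :
  measurable_fun [set: n.+1.-tuple R] F -> (forall z, 0 <= F z) ->
  measurable_fun [set: R]
    (fun x => (gdens sigma x)%:E * gauss_iter sigma (fun z => F (cons_tuple x z))).
Proof.
move=> mF F0; apply: emeasurable_funM.
  by apply/measurable_EFinP; exact: measurable_gdens.
apply: (@measurable_gauss_iter n _ R (fun x z => F (cons_tuple x z))) => //.
by apply: measurableT_comp => //; exact: measurable_cons.
Qed.

Lemma measurable_cons_tuple n (F : n.+1.-tuple R -> \bar R) (x : R) :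
  measurable_fun [set: n.+1.-tuple R] F ->
  measurable_fun [set: n.-tuple R] (fun z => F (cons_tuple x z)).
Proof. by move=> mF; apply: measurableT_comp => //; exact: measurable_cons. Qed.

Lemma le_gauss_iter n (F G : n.-tuple R -> \bar R) :
  measurable_fun [set: n.-tuple R] F -> measurable_fun [set: n.-tuple R] G ->
  (forall z, 0 <= F z) -> (forall z, F z <= G z) ->
  gauss_iter sigma F <= gauss_iter sigma G.
Proof.
elim: n F G => [|n IH] F G mF mG F0 FG //=.
have G0 z : 0 <= G z by exact: le_trans (FG z).
apply: ge0_le_integral => //.
- by move=> x _; rewrite mule_ge0 ?gauss_iter_ge0// lee_fin gdens_ge0.
- exact: measurable_gauss_iter_cons.
- exact: measurable_gauss_iter_cons.
- move=> x _; apply: lee_wpmul2l; first by rewrite lee_fin gdens_ge0.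
  by apply: IH => //; exact: measurable_cons_tuple.
Qed.

Lemma gauss_iterD n (F G : n.-tuple R -> \bar R) :
  measurable_fun [set: n.-tuple R] F -> measurable_fun [set: n.-tuple R] G ->
  (forall z, 0 <= F z) -> (forall z, 0 <= G z) ->
  gauss_iter sigma (fun z => F z + G z) = gauss_iter sigma F + gauss_iter sigma G.
Proof.
elim: n F G => [|n IH] F G mF mG F0 G0 //=.
rewrite -ge0_integralD//.
- apply: eq_integral => x _; rewrite IH//; try exact: measurable_cons_tuple.
  by rewrite ge0_muleDr// gauss_iter_ge0.
- by move=> x _; rewrite mule_ge0 ?gauss_iter_ge0// lee_fin gdens_ge0.
- exact: measurable_gauss_iter_cons.
- by move=> x _; rewrite mule_ge0 ?gauss_iter_ge0// lee_fin gdens_ge0.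
- exact: measurable_gauss_iter_cons.
Qed.

Lemma gauss_iter_cst0 n : gauss_iter sigma (fun _ : n.-tuple R => 0) = 0.
Proof.
by elim: n => [//|n IH] /=; rewrite integral0_eq// => x _; rewrite IH mule0.
Qed.

Lemma gauss_iter_cst1 n : gauss_iter sigma (fun _ : n.-tuple R => 1) = 1.
Proof.
elim: n => [//|n IH] /=.
by under eq_integral do rewrite IH mule1; exact: integral_gdens.
Qed.

Lemma gauss_iter_sum n (I : Type) (s : seq I) (F : I -> n.-tuple R -> \bar R) :
  (forall i, measurable_fun [set: n.-tuple R] (F i)) ->
  (forall i z, 0 <= F i z) ->
  gauss_iter sigma (fun z => \sum_(i <- s) F i z) =
  \sum_(i <- s) gauss_iter sigma (F i).
Proof.
move=> mF F0; elim: s => [|i s IH].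
  rewrite big_nil -[RHS](gauss_iter_cst0 n); congr gauss_iter.
  by apply/funext => z; rewrite big_nil.
rewrite big_cons -IH -gauss_iterD//.
- by congr gauss_iter; apply/funext => z; rewrite big_cons.
- exact: emeasurable_sum.
- by move=> z; rewrite sume_ge0.
Qed.

Lemma gauss_prob_le1 n (A : set (n.-tuple R)) : measurable A ->
  gauss_prob sigma A <= 1.
Proof.
move=> mA; rewrite -(gauss_iter_cst1 n); apply: le_gauss_iter => //.
- by apply/measurable_EFinP.
- by move=> z; rewrite lee_fin.
Qed.

Lemma gauss_prob_fin_num n (A : set (n.-tuple R)) : measurable A ->
  gauss_prob sigma A \is a fin_num.
Proof.
move=> mA; rewrite ge0_fin_numE; last by apply: gauss_iter_ge0 => z; rewrite lee_fin.
by rewrite (le_lt_trans (gauss_prob_le1 mA))// ltry.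
Qed.

End gauss_iter.

(** * Intersections of half-spaces *)

Section orthants.
Context (R : realType) (sigma : R).
Hypothesis sigma0 : 0 < sigma.
Notation V := (R * R * R)%type.

Definition orthant (b1 b2 b3 : R) : set V :=
  [set v | [/\ v.1.1 < b1, v.1.2 < b2 & v.2 < b3]].

Definition halfspaces n (u1 u2 u3 : 'I_n -> R) (b1 b2 b3 : R) : set (n.-tuple R) :=
  [set z | [/\ \sum_(t < n) tnth z t * u1 t < b1,
    \sum_(t < n) tnth z t * u2 t < b2 & \sum_(t < n) tnth z t * u3 t < b3]].

Lemma measurable_ltr_cst (d : measure_display) (T : measurableType d) (f : T -> R)
    (b : R) : measurable_fun [set: T] f -> measurable [set x | f x < b].
Proof.
move=> mf; rewrite (_ : [set x | _] = f @^-1` [set` `]-oo, b[]).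
  by rewrite -[X in measurable X]setTI; apply: mf => //; exact: measurable_itv.
by apply/seteqP; split => x /=; rewrite in_itv.
Qed.

Lemma measurable_orthant b1 b2 b3 : measurable (orthant b1 b2 b3).
Proof.
rewrite (_ : orthant _ _ _ = [set v | v.1.1 < b1] `&` [set v | v.1.2 < b2] `&`
   [set v | v.2 < b3]); last first.
  by apply/seteqP; split => v /= => [[]|[[]]].
apply: measurableI; first apply: measurableI.
- by apply: (@measurable_ltr_cst _ V (fun v : V => v.1.1)); exact: measurableT_comp.
- by apply: (@measurable_ltr_cst _ V (fun v : V => v.1.2)); exact: measurableT_comp.
- by apply: (@measurable_ltr_cst _ V (fun v : V => v.2)); exact: measurable_snd.
Qed.

Lemma measurable_halfspace n (u : 'I_n -> R) (b : R) :
  measurable [set z : n.-tuple R | \sum_(t < n) tnth z t * u t < b].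
Proof.
apply: measurable_ltr_cst; apply: measurable_sum => t.
by apply: measurable_funM => //; exact: measurable_tnth.
Qed.

Lemma measurable_halfspaces n (u1 u2 u3 : 'I_n -> R) b1 b2 b3 :
  measurable (halfspaces u1 u2 u3 b1 b2 b3).
Proof.
rewrite (_ : halfspaces _ _ _ _ _ _ =
   [set z : n.-tuple R | \sum_(t < n) tnth z t * u1 t < b1] `&`
   [set z : n.-tuple R | \sum_(t < n) tnth z t * u2 t < b2] `&`
   [set z : n.-tuple R | \sum_(t < n) tnth z t * u3 t < b3]); last first.
  by apply/seteqP; split => v /= => [[]|[[]]].
by do 2?apply: measurableI; exact: measurable_halfspace.
Qed.

Lemma gauss_prob_halfspaces_cols n (u1 u2 u3 : 'I_n -> R) b1 b2 b3 :
  gauss_prob sigma (halfspaces u1 u2 u3 b1 b2 b3) =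
  gauss_cols sigma [tuple (u1 t, u2 t, u3 t) | t < n]
    (fun v => (\1_(orthant b1 b2 b3) v)%:E) 0.
Proof.
rewrite -gauss_iter_linear /gauss_prob; congr gauss_iter; apply/funext => z.
rewrite add0r (_ : \sum_(i < n) _ = (\sum_(t < n) tnth z t * u1 t,
  \sum_(t < n) tnth z t * u2 t, \sum_(t < n) tnth z t * u3 t))//.
under eq_bigr do rewrite tnth_mktuple.
by elim: (index_enum _) => [|t r IH]; rewrite ?big_nil// !big_cons IH.
Qed.

(** The columns on the right form the triangular matrix with rows [(1, 0, 0)], [(c, s, 0)],
    [(e1, e2, e3)]; the hypotheses say that these rows have the Gram matrix of [u1], [u2], [u3]. *)
Lemma gauss_prob_halfspaces n (u1 u2 u3 : 'I_n -> R) b1 b2 b3 (c s e1 e2 e3 : R) :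
  0 < s ->
  \sum_t u1 t * u1 t = 1 -> \sum_t u1 t * u2 t = c ->
  \sum_t u2 t * u2 t = c ^+ 2 + s ^+ 2 -> \sum_t u1 t * u3 t = e1 ->
  \sum_t u2 t * u3 t = c * e1 + s * e2 ->
  e3 = Num.sqrt (\sum_t u3 t * u3 t - e1 ^+ 2 - e2 ^+ 2) ->
  gauss_prob sigma (halfspaces u1 u2 u3 b1 b2 b3) =
  gauss_cols sigma [:: (1, c, e1); (0, s, e2); (0, 0, e3)]
    (fun v => (\1_(orthant b1 b2 b3) v)%:E) 0.
Proof.
move=> s0 g11 g12 g22 g13 g23 ->.
have gramE (f g : V -> R) : gram f g [tuple (u1 t, u2 t, u3 t) | t < n] =
    \sum_t f (u1 t, u2 t, u3 t) * g (u1 t, u2 t, u3 t).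
  rewrite /gram big_tuple; apply: eq_bigr => t _; by rewrite tnth_mktuple.
rewrite gauss_prob_halfspaces_cols; apply: gauss_cols_gram => //.
- by rewrite gramE/= g11 expr1n.
- by rewrite gramE/= g12 mul1r.
- by rewrite gramE/= g13 mul1r.
- by rewrite gramE/= g22.
- by rewrite gramE/= g23.
- by rewrite gramE.
- by apply/measurable_EFinP/measurable_indic; exact: measurable_orthant.
Qed.

End orthants.

(** * Geometry of the BPSK images *)

(** The cardinals in [wH] and [tetra_spec] are over classical sets; this gives back the boolean
    membership test. *)
Lemma mem_in_set (T : Type) (P : pred T) x : (x \in in_set [set y | P y]) = P x.
Proof. exact: asboolb. Qed.

Lemma wH_eq0 n (c : 'rV['F_2]_n) : (wH c == 0)%N = (c == 0).
Proof.
apply/idP/eqP => [/eqP/card0_eq c0|->].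
  by apply/rowP => t; have := c0 t; rewrite mem_in_set inE mxE => /negbFE/eqP.
by apply/eqP/eq_card0 => t; rewrite mem_in_set mxE eqxx.
Qed.

Lemma wH_le n (c : 'rV['F_2]_n) : (wH c <= n)%N.
Proof. by rewrite /wH (leq_trans (max_card _))// card_ord. Qed.

Section bpsk_geometry.
Context (R : realType) (n : nat).
Implicit Types (a b c : 'rV['F_2]_n).

Definition supp c (t : 'I_n) : R := (c 0 t != 0)%:R.

Lemma natr_wH c : (wH c)%:R = \sum_t supp c t.
Proof.
rewrite /wH -sum1_card natr_sum big_mkcond/=; apply: eq_bigr => t _.
by rewrite mem_in_set; case: ifPn => [|/negbTE]; rewrite /supp => ->.
Qed.

Lemma suppM c t : supp c t * supp c t = supp c t.
Proof. by rewrite /supp; case: (_ != _); rewrite ?mulr1 ?mulr0. Qed.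

(** Over ['F_2] the support of [b - a] is the symmetric difference of the supports. *)
Lemma suppB a b t : supp (b - a) t = supp a t + supp b t - 2 * (supp a t * supp b t).
Proof.
rewrite /supp !mxE.
have F2 (x : 'F_2) : x = 0 \/ x = 1.
  by case: x => -[|[|//]] xP; [left|right]; apply/val_inj.
by case: (F2 (a 0 t)) => ->; case: (F2 (b 0 t)) => -> /=;
  rewrite ?subrr ?subr0 ?sub0r ?oppr_eq0 ?oner_eq0 ?eqxx/=; ring.
Qed.

Lemma sum_suppM a b :
  \sum_t supp a t * supp b t = ((wH a)%:R + (wH b)%:R - (wH (b - a))%:R) / 2.
Proof.
rewrite !natr_wH (eq_bigr _ (fun t _ => suppB a b t)) sumrB big_split/= -mulr_sumr.
set x := \sum_t supp a t * _; set y := \sum_t supp a t; set z := \sum_t supp b t.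
by field.
Qed.

(* The unit vector along bpsk c - bpsk 0, whose entries are - 2 on the support of c *)
Definition udir c (t : 'I_n) : R := - supp c t / Num.sqrt (wH c)%:R.

(** The law of cosines, in the form in which [theta], [dir1] and [dir2] quote it. *)
Lemma sum_udirM a b : \sum_t udir a t * udir b t =
  ((wH a)%:R + (wH b)%:R - (wH (b - a))%:R) / (2 * Num.sqrt ((wH a)%:R * (wH b)%:R)).
Proof.
under eq_bigr => t _ do rewrite /udir mulrACA mulrNN.
rewrite -mulr_suml sum_suppM sqrtrM// -!invfM; rewrite -mulrA -invfM//.
Qed.

Lemma sum_udir_sqr c : (1 <= wH c)%N -> \sum_t udir c t * udir c t = 1.
Proof.
move=> c1; rewrite sum_udirM subrr (_ : wH 0 = 0)%N; last by apply/eqP; rewrite wH_eq0.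
rewrite -expr2 sqrtr_sqr ger0_norm// subr0 -mulr2n mulr_natl divff//.
by rewrite mulrn_eq0/= pnatr_eq0 -lt0n.
Qed.

(** The two signal points are at distance [2 * Num.sqrt (wH c)%:R], so their bisector lies at half
    of it; ties count as errors, whence the negated strict inequality. *)
Lemma sqdist_lt_udir (z : n.-tuple R) c : (1 <= wH c)%N ->
  (sqdist (received z) (bpsk R c) <= sqdist (received z) (bpsk R 0)) =
  ~~ (\sum_(t < n) tnth z t * udir c t < Num.sqrt (wH c)%:R).
Proof.
move=> c1; rewrite -leNgt.
have w0 : 0 < Num.sqrt (wH c)%:R :> R by rewrite sqrtr_gt0 ltr0n.
have -> : \sum_(t < n) tnth z t * udir c t =
    (\sum_t - (tnth z t * supp c t)) / Num.sqrt (wH c)%:R.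
  by rewrite mulr_suml; apply: eq_bigr => t _; rewrite /udir mulrA mulrN.
rewrite ler_pdivlMr// -expr2 sqr_sqrtr// natr_wH -subr_le0 -[RHS]subr_le0.
rewrite -sumrB /sqdist -sumrB.
(* On the support of [c] the summand is [(2 + z_t)^2 - z_t^2 = 4 * (1 + z_t)]; elsewhere it is
   zero. *)
rewrite (_ : \sum_(i < n) (_ - _) = 4 * \sum_t (supp c t - - (tnth z t * supp c t))).
  by rewrite pmulr_rle0.
rewrite mulr_sumr; apply: eq_bigr => t _; rewrite /received /bpsk /supp mxE eqxx.
by case: eqP => _ /=; ring.
Qed.

(** Strict Cauchy-Schwarz: the overlap [m] of the supports is at most each weight, and
    [wH (b - a) >= 1] prevents equality with both, so [m ^+ 2] is less than their product. *)
Lemma cos_udir_lt1 a b : (1 <= wH a)%N -> (1 <= wH b)%N -> (1 <= wH (b - a))%N ->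
  (\sum_t udir a t * udir b t) ^+ 2 < 1.
Proof.
move=> a1 b1 ab1.
set m := \sum_t supp a t * supp b t.
have m0 : 0 <= m by apply: sumr_ge0 => t _; rewrite mulr_ge0.
have ma : m <= (wH a)%:R.
  rewrite natr_wH; apply: ler_sum => t _.
  by rewrite /supp; case: (_ != _); case: (_ != _); rewrite ?mulr1 ?mulr0.
have mb : m <= (wH b)%:R.
  rewrite natr_wH; apply: ler_sum => t _.
  by rewrite /supp; case: (_ != _); case: (_ != _); rewrite ?mulr1 ?mulr0.
have mab : (wH a)%:R + (wH b)%:R - 2 * m = (wH (b - a))%:R.
  by rewrite /m sum_suppM; field.
under eq_bigr => t _ do rewrite /udir mulrACA mulrNN -invfM.
rewrite -mulr_suml -/m -sqrtrM// expr_div_n sqr_sqrtr//.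
move: a1 b1 ab1; rewrite -!(ler_nat R) => a1 b1 ab1.
rewrite ltr_pdivrMr ?mul1r; nra.
Qed.

End bpsk_geometry.

(** * The error event *)

Section code.
Context (R : realType) (sigma : R) (n : nat) (c1 c2 : 'rV['F_2]_n).
Hypothesis sigma0 : 0 < sigma.
Hypotheses (c1_gt0 : (1 <= wH c1)%N) (c2_gt0 : (1 <= wH c2)%N)
  (c12_gt0 : (1 <= wH (c2 - c1))%N).
Notation V := (R * R * R)%type.
Notation th := (theta R (wH c1) (wH c2) (wH (c2 - c1))).

Let acos_bounds : -1 <= \sum_t udir R c1 t * udir R c2 t <= 1.
Proof.
rewrite -ler_norml -(@expr_le1 _ 2)// real_normK ?num_real//.
by apply: ltW; exact: cos_udir_lt1.
Qed.

Lemma cos_theta : cos th = \sum_t udir R c1 t * udir R c2 t.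
Proof. by rewrite /theta -sum_udirM acosK// in_itv. Qed.

(** Makes the division in [dir2] meaningful and provides the positive second pivot of the triangular
    form. *)
Lemma sin_theta_gt0 : 0 < sin th.
Proof.
rewrite /theta -sum_udirM sin_acos// sqrtr_gt0 subr_gt0.
exact: cos_udir_lt1.
Qed.

(* The two-codeword event has the third half-space constraint 0 < 1. *)
Definition no_error2 : set (n.-tuple R) :=
  halfspaces (udir R c1) (udir R c2) (fun=> 0)
    (Num.sqrt (wH c1)%:R) (Num.sqrt (wH c2)%:R) 1.

Definition no_error3 c : set (n.-tuple R) :=
  halfspaces (udir R c1) (udir R c2) (udir R c)
    (Num.sqrt (wH c1)%:R) (Num.sqrt (wH c2)%:R) (Num.sqrt (wH c)%:R).

Lemma gauss_prob_linear_preimage m (vs : m.-tuple V) (B : set V) (A : set (m.-tuple R)) :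
  (forall xi, A xi <-> B (\sum_(i < m) tnth xi i *: tnth vs i)) ->
  gauss_prob sigma A = gauss_cols sigma vs (fun v => (\1_B v)%:E) 0.
Proof.
move=> AB; rewrite -gauss_iter_linear /gauss_prob; congr gauss_iter.
apply/funext => xi; rewrite add0r !indicE; congr ((nat_of_bool _)%:R%:E).
by apply/idP/idP; rewrite !inE => /AB.
Qed.

Let scaleE (a b : R) : a *: b = a * b. Proof. by []. Qed.

Lemma p3_no_error2 : p3 sigma (wH c1) (wH c2) (wH (c2 - c1)) =
  1 - fine (gauss_prob sigma no_error2).
Proof.
rewrite /p3; congr (1 - fine _).
apply/esym/(etrans (gauss_prob_halfspaces sigma0 _ _ _ (c := cos th) (s := sin th)
   (e1 := 0) (e2 := 0) (e3 := 0) _ _ _ _ _ _ _)).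
- exact: sin_theta_gt0.
- by rewrite sum_udir_sqr.
- by rewrite cos_theta.
- by rewrite sum_udir_sqr// cos2Dsin2.
- by rewrite big1// => t _; rewrite mulr0.
- by rewrite big1 ?mulr0 ?addr0// => t _; rewrite mulr0.
- by rewrite big1 ?expr0n/= ?subr0 ?sqrtr0// => t _; rewrite mulr0.
(* The third column is zero and integrates out, leaving the two variables of [p3]. *)
- apply: etrans (@gauss_cols_equiv_zeros _ _ sigma0 [:: (1, cos th, 0); (0, sin th, 0)]
    [:: (0, 0, 0)] _ _ _ _ _) _.
  + by move=> v; rewrite inE => /eqP.
  + by apply/measurable_EFinP/measurable_indic; exact: measurable_orthant.
  + by move=> q; rewrite lee_fin.
  + apply/esym/(gauss_prob_linear_preimage
      (vs := [tuple (1, cos th, 0); (0, sin th, 0)])) => xi.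
    rewrite !big_ord_recl big_ord0 /= !(tnth_nth 0)/= !inordK//=.
    rewrite /orthant/= !scaleE /bump/= !addr0 !mulr1 !mulr0.
    by rewrite addr0; split => [[? ?]|[]]; split.
Qed.

(** [dir1], [dir2], [dir3] form the last row of the triangular factor: the first two solve the
    equations for the inner products with the directions of [c1] and [c2], and [dir3] completes a
    unit vector. *)
Lemma p4_no_error3 c : (1 <= wH c)%N ->
  p4 sigma (wH c1) (wH c2) (wH (c2 - c1)) (wH c) (wH (c - c1)) (wH (c - c2)) =
  1 - fine (gauss_prob sigma (no_error3 c)).
Proof.
move=> c_gt0; rewrite /p4; congr (1 - fine _).
set e1 := dir1 R _ _ _; set e2 := dir2 R _ _ _ _ _ _; set e3 := dir3 R _ _ _ _ _ _.
have st0 := sin_theta_gt0.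
apply/esym/(etrans (gauss_prob_halfspaces sigma0 _ _ _ (c := cos th) (s := sin th)
   (e1 := e1) (e2 := e2) (e3 := e3) _ _ _ _ _ _ _)).
- exact: st0.
- by rewrite sum_udir_sqr.
- by rewrite cos_theta.
- by rewrite sum_udir_sqr// cos2Dsin2.
- by rewrite sum_udirM.
- rewrite sum_udirM /e2 /dir2 -/e1 [sin th * _]mulrC divfK ?gt_eqF//; ring.
- by rewrite sum_udir_sqr.
- apply/esym/(gauss_prob_linear_preimage
    (vs := [tuple (1, cos th, e1); (0, sin th, e2); (0, 0, e3)])) => xi.
  rewrite !big_ord_recl big_ord0 /= !(tnth_nth 0)/= !inordK//=.
  rewrite /orthant/= !scaleE /bump/= !addr0 !mulr1 !mulr0.
  by rewrite !addr0 !addrA; split => [[? ? ?]|[]]; split.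
Qed.

(** A finite union of closed half-spaces: this form serves both measurability and the pointwise
    argument. *)
Lemma error_eventE (C : {vspace 'rV['F_2]_n}) :
  @error_event R n C = \bigcup_(c in [set c | c \in C /\ c != 0])
    ~` [set z : n.-tuple R |
        \sum_(t < n) tnth z t * udir R c t < Num.sqrt (wH c)%:R].
Proof.
have w c : c != 0 -> (1 <= wH c)%N by rewrite lt0n wH_eq0.
apply/seteqP; split => z /=.
  by move=> [c [cC c0 le]]; exists c => //=; apply/negP; rewrite -sqdist_lt_udir// w.
by move=> [c /= [cC c0] /negP]; rewrite -sqdist_lt_udir ?w// => le; exists c.
Qed.

Lemma measurable_error_event (C : {vspace 'rV['F_2]_n}) : measurable (@error_event R n C).
Proof.
rewrite error_eventE; apply: fin_bigcup_measurable => [|c _]; first exact: finite_finset.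
by apply: measurableC; exact: measurable_halfspace.
Qed.

Lemma no_error3_sub c : no_error3 c `<=` no_error2.
Proof.
move=> z [h1 h2 _]; split => //.
by rewrite big1// => t _; rewrite mulr0.
Qed.

(** * Pointwise inequality and the remaining codewords *)

Variable C : {vspace 'rV['F_2]_n}.
Hypotheses (c1C : c1 \in C) (c2C : c2 \in C).

Definition other_word c := [&& c \in C, c != 0, c != c1 & c != c2].

(** Outside [no_error2] only the error indicator remains on the left, and it is at most 1. Inside,
    each [no_error3] term is at most 1, and an error forces one of them to be 0. *)
Lemma error_event_indic z :
  \1_(@error_event R n C) z + (\1_no_error2 z + \sum_(c | other_word c) \1_(no_error3 c) z)
  <= 1 + \sum_(c | other_word c) \1_no_error2 z :> R.
Proof.
have [z2|z2] := boolP (z \in no_error2); last first.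
  rewrite [\1_no_error2 z]indicE (negbTE z2) !big1_eq big1 ?addr0; last first.
    move=> c _; rewrite indicE; case: (boolP (z \in no_error3 c)) => //.
    by rewrite inE => /no_error3_sub/mem_set; rewrite (negbTE z2).
  by rewrite indicE lern1 leq_b1.
rewrite [\1_no_error2 z]indicE z2 addrCA lerD2l indicE.
have le1 c : \1_(no_error3 c) z <= 1 :> R by rewrite indicE lern1 leq_b1.
have [|_] := boolP (z \in @error_event R n C); last by rewrite add0r; exact: ler_sum.
rewrite inE error_eventE => -[c /= [cC c0] nz].
have [h1 h2 _] := set_mem z2.
(* [h1] and [h2] say that [c1] and [c2] do not beat the zero word, so the offending [c] is neither
   of them. *)
have oc : other_word c.
  rewrite /other_word cC c0/=; apply/andP; split; apply/eqP => cE; move: nz; rewrite cE.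
    by move=> /(_ h1).
  by move=> /(_ h2).
rewrite (bigD1 c)//= [X in _ <= X](bigD1 c)//= indicE memNset; last first.
  by move=> [_ _].
by rewrite add0r lerD2l; exact: ler_sum.
Qed.

Lemma card_other_word : \sum_(c | other_word c) 1 = (2 ^ \dim C)%:R - 3 :> R.
Proof.
(* The three positive weights make [0], [c1], [c2] distinct, so exactly three codewords are
   removed. *)
have c10 : c1 != 0 by rewrite -wH_eq0 -lt0n.
have c20 : c2 != 0 by rewrite -wH_eq0 -lt0n.
have c21 : c2 != c1 by rewrite -subr_eq0 -wH_eq0 -lt0n.
have -> : (2 ^ \dim C)%:R = \sum_(c in C) 1 :> R.
  by rewrite sumr_const; congr (_%:R); rewrite card_vspace card_Fp.
rewrite [in RHS](bigD1 0) ?mem0v//= [in RHS](bigD1 c1) ?c1C ?c10//=.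
rewrite [in RHS](bigD1 c2) ?c2C ?c20 ?c21//=.
rewrite [in RHS](eq_bigl other_word); last by move=> c; rewrite /other_word -!andbA.
by ring.
Qed.

(** Each codeword falls in the one cell given by its three weights, and this cell is in the range of
    summation exactly when the codeword is none of [0], [c1], [c2]. *)
Lemma sum_tetra_spec (f : nat -> nat -> nat -> R) :
  \sum_(1 <= i < n.+1) \sum_(1 <= j < n.+1) \sum_(1 <= h < n.+1)
    (tetra_spec C c1 c2 i j h)%:R * f i j h =
  \sum_(c | other_word c) f (wH c) (wH (c - c1)) (wH (c - c2)).
Proof.
have tE i j h : (tetra_spec C c1 c2 i j h)%:R * f i j h =
    \sum_(c in C) (if i == wH c then if j == wH (c - c1) then
      if h == wH (c - c2) then f i j h else 0 else 0 else 0).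
  rewrite /tetra_spec -sum1_card natr_sum mulr_suml big_mkcond [RHS]big_mkcond/=.
  apply: eq_bigr => c _; rewrite mem_in_set; case: (c \in C) => //=.
  rewrite ![_ == wH _]eq_sym.
  by do 3 case: (_ == _); rewrite ?mul1r.
under eq_bigr => i _ do under eq_bigr => j _ do under eq_bigr => h _ do rewrite tE.
under eq_bigr => i _ do under eq_bigr => j _ do rewrite exchange_big.
under eq_bigr => i _ do rewrite exchange_big.
rewrite exchange_big [RHS]big_mkcondr/=.
apply: eq_bigr => c cC.
(* Starting at 1 discards [a = 0]; [wH_le] keeps every other weight in range. *)
have rg (a : 'rV['F_2]_n) (g : nat -> R) :
    \sum_(1 <= i < n.+1) (if i == wH a then g i else 0) =
    if a != 0 then g (wH a) else 0.
  by rewrite -big_mkcond big_nat1_eq ltnS wH_le andbT lt0n wH_eq0.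
have sumif (b : bool) (g : nat -> R) :
   \sum_(1 <= i < n.+1) (if b then g i else 0) =
    if b then \sum_(1 <= i < n.+1) g i else 0 by case: b => //; rewrite big1_eq.
under eq_bigr => i _ do under eq_bigr => j _ do rewrite !sumif rg.
under eq_bigr => i _ do rewrite sumif rg.
rewrite rg !subr_eq0.
by do 3 case: (_ != _).
Qed.

End code.

(** * Integration of the pointwise inequality *)

Theorem theorem2 (R : realType) (n k : nat) (C : {vspace 'rV['F_2]_n})
  (sigma : R) (c1 c2 : 'rV['F_2]_n) :
  \dim C = k -> 0 < sigma ->
  c1 \in C -> c2 \in C ->
  (1 <= wH c1)%N -> (1 <= wH c2)%N -> (1 <= wH (c2 - c1))%N ->
  (gauss_prob sigma (@error_event R n C) <=
    (- ((2 ^ k)%:R - 4) * p3 sigma (wH c1) (wH c2) (wH (c2 - c1))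
     + \sum_(1 <= i < n.+1) \sum_(1 <= j < n.+1) \sum_(1 <= h < n.+1)
         (tetra_spec C c1 c2 i j h)%:R
           * p4 sigma (wH c1) (wH c2) (wH (c2 - c1)) i j h)%:E)%E.
Proof.
move=> <- sigma0 c1C c2C c1_gt0 c2_gt0 c12_gt0.
rewrite sum_tetra_spec p3_no_error2//.
under eq_bigr => c oc.
  rewrite p4_no_error3//; first over.
  by case/and4P: oc => _; rewrite lt0n wH_eq0.
pose s := [seq c <- index_enum 'rV['F_2]_n | other_word c1 c2 C c].
have m2 : measurable (@no_error2 R n c1 c2) by exact: measurable_halfspaces.
have m3 c : measurable (@no_error3 R n c1 c2 c) by exact: measurable_halfspaces.
have mE := @measurable_error_event R n C.
have mI (A : set (n.-tuple R)) : measurable A ->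
    measurable_fun [set: n.-tuple R] (fun z => (\1_A z : R)%:E).
  by move=> mA; apply/measurable_EFinP/measurable_indic.
have I0 (A : set (n.-tuple R)) z : (0 <= (\1_A z : R)%:E)%E by rewrite lee_fin.
have key : (gauss_prob sigma (@error_event R n C) + (gauss_prob sigma (@no_error2 R n c1 c2) +
    \sum_(c <- s) gauss_prob sigma (@no_error3 R n c1 c2 c)) <=
    1 + \sum_(c <- s) gauss_prob sigma (@no_error2 R n c1 c2))%E.
  have ms (F : 'rV['F_2]_n -> set (n.-tuple R)) : (forall c, measurable (F c)) ->
      measurable_fun [set: n.-tuple R] (fun z => \sum_(c <- s) (\1_(F c) z : R)%:E)%E.
    by move=> mF; apply: emeasurable_sum => c; exact: mI.
  have s0 (F : 'rV['F_2]_n -> set (n.-tuple R)) z :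
      (0 <= \sum_(c <- s) (\1_(F c) z : R)%:E)%E by rewrite sume_ge0.
  rewrite /gauss_prob -!gauss_iter_sum//; try by move=> c; exact: mI.
  rewrite -(gauss_iter_cst1 sigma0 n) -!gauss_iterD//; try exact: mI; try exact: ms.
  - apply: le_gauss_iter => //.
    + apply: emeasurable_funD; first exact: mI.
      by apply: emeasurable_funD; [exact: mI|exact: ms].
    + by apply: emeasurable_funD => //; exact: ms.
    + by move=> z; rewrite !adde_ge0.
    + move=> z; rewrite !sumEFin -!EFinD lee_fin !big_filter.
      exact: error_event_indic.
  - by apply: emeasurable_funD; [exact: mI|exact: ms].
  - by move=> z; rewrite adde_ge0.
(* All probabilities are finite, so [key] becomes an inequality between reals. *)
have fin (A : set (n.-tuple R)) : measurable A ->
    gauss_prob sigma A = (fine (gauss_prob sigma A))%:E.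
  by move=> mA; rewrite fineK// gauss_prob_fin_num.
rewrite (fin _ mE) lee_fin.
rewrite (fin _ mE) (fin _ m2) (eq_bigr _ (fun c _ => fin _ (m3 c))) in key.
rewrite !sumEFin -!EFinD lee_fin !big_filter in key.
rewrite sumrB (card_other_word R)//.
have e : \sum_(c | other_word c1 c2 C c) fine (gauss_prob sigma (@no_error2 R n c1 c2)) =
    ((2 ^ \dim C)%:R - 3) * fine (gauss_prob sigma (@no_error2 R n c1 c2)).
  rewrite -(card_other_word R c1_gt0 c2_gt0 c12_gt0)// mulr_suml.
  by apply: eq_bigr => c _; rewrite mul1r.
(* With [N = 2 ^ \dim C - 3], the constants of the goal add up to [N - (N - 1) = 1], and the
   probability of [no_error2] gets the coefficient [N - 1], as in [key]. *)
rewrite e in key; lra.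
Qed.
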